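(* Consider a Knapsack Game instance and a player $i$. Let $j$ and $j'$ be two items such that the dominance rule applies with $\bar{p}_j = p^{\min}_j$ and $\bar{p}_{j'} = p^{\max}_{j'}$, i.e., $w^i_j \le w^i_{j'}$ and $p^{\min}_j > p^{\max}_{j'}$, where $p^{\min}_j$ (respectively $p^{\max}_{j'}$) is the minimum (respectively maximum) profit of item $j$ (respectively $j'$) for player $i$ that the strategies of the other players can induce. Then the inequality $x^i_{j'} \le x^i_j$ is an equilibrium inequality, i.e., it is satisfied by every point of the perfect equilibrium formulation $\mathcal{E}$ of the game.
   Context: Knapsack Game (KPG): a game among $n$ players with $m$ items in which each player $i$ solves $$\max_{x^i}\Big\{\sum_{j=1}^{m} p^i_j x^i_j + \sum_{k=1,k\neq i}^{n}\sum_{j=1}^{m} C^i_{k,j} x^i_j x^k_j : \sum_{j=1}^{m} w^i_j x^i_j \le b^i,\ x^i \in \{0,1\}^m\Big\},$$ where the profits $p^i_j$, weights $w^i_j$ and capacities $b^i$ are non-negative integers and the coefficients $C^i_{k,j}$ are integers. Let $\mathcal{X}^i$ be the feasible set of player $i$ and $u^i(x^i,x^{-i})$ its objective value. Induced profit: given opponents' strategies $x^{-i}$, the profit of item $j$ for player $i$ is $p^i_j + \sum_{k\neq i} C^i_{k,j} x^k_j$; $p^{\min}_j$ and $p^{\max}_j$ are its minimum and maximum over the opponents' feasible strategies $x^{-i}\in\prod_{k\neq i}\mathcal{X}^k$. Dominance rule: given two items $j$ and $j'$ with profits $\bar{p}_j,\bar{p}_{j'}$ and weights $w_j,w_{j'}$,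 item $j$ dominates item $j'$ if $w_j \le w_{j'}$ and $\bar{p}_j > \bar{p}_{j'}$. A pure Nash equilibrium is a profile $\bar{x}$ with $\bar{x}^i\in\mathcal{X}^i$ and $u^i(\bar{x}^i,\bar{x}^{-i}) \ge u^i(\hat{x}^i,\bar{x}^{-i})$ for every player $i$ and every $\hat{x}^i\in\mathcal{X}^i$; $\mathcal{N}$ is the set of pure Nash equilibria. Lifted space: the bilinear products $x^i_j x^k_j$ are linearized by auxiliary binary variables $z$ (one per product, with the standard constraints $z\le x^i_j$, $z\le x^k_j$, $z\ge x^i_j+x^k_j-1$), and $\mathcal{K}$ is the set of all $(x,z)$ with $x^i\in\mathcal{X}^i$ for all $i$ and $z$ binary satisfying these constraints. The perfect equilibrium formulation is $\mathcal{E} = \{(x,z)\in\operatorname{conv}(\mathcal{K}) : x\in\operatorname{conv}(\mathcal{N})\}$, and an equilibrium inequality is an inequality valid for $\mathcal{E}$. *)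

(* Defs.v *)
From mathcomp Require Import all_boot all_order all_algebra.
From mathcomp Require Import all_classical all_reals convex.

Set Implicit Arguments.
Unset Strict Implicit.
Unset Printing Implicit Defensive.

Import Order.TTheory GRing.Theory Num.Theory.

Local Open Scope classical_set_scope.
Local Open Scope ring_scope.

(* [interaction i k j] is C^i_{k,j}; its values at k = i are never used. *)
Record kpg (n m : nat) := Kpg {
  profit : 'I_n -> 'I_m -> nat;
  weight : 'I_n -> 'I_m -> nat;
  capacity : 'I_n -> nat;
  interaction : 'I_n -> 'I_n -> 'I_m -> int
}.

Definition strategy (m : nat) : finType := {ffun 'I_m -> bool}.

Definition profile (n m : nat) : finType := {ffun 'I_n -> strategy m}.

Definition feasible (n m : nat) (G : kpg n m) (i : 'I_n) (y : strategy m) : bool :=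
  (\sum_(j < m) weight G i j * y j <= capacity G i)%N.

(* u^i(y, x^{-i}): the component x i of the profile is not used. *)
Definition utility (n m : nat) (G : kpg n m) (i : 'I_n) (y : strategy m)
    (x : profile n m) : int :=
  \sum_(j < m) (profit G i j)%:Z * (y j)%:R +
  \sum_(k < n | k != i) \sum_(j < m)
     interaction G i k j * (y j)%:R * (x k j)%:R.

Definition nash (n m : nat) (G : kpg n m) (x : profile n m) : Prop :=
  forall i : 'I_n, feasible G i (x i) /\
    forall y : strategy m, feasible G i y -> utility G i y x <= utility G i (x i) x.

(* An opponents' profile x^{-i} is encoded by a full profile whose component i
   is arbitrary and ignored. *)
Definition opp_feasible (n m : nat) (G : kpg n m) (i : 'I_n) (x : profile n m) : bool :=
  [forall k : 'I_n, (k != i) ==> feasible G k (x k)].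

Definition induced_profit (n m : nat) (G : kpg n m) (i : 'I_n) (j : 'I_m)
    (x : profile n m) : int :=
  (profit G i j)%:Z + \sum_(k < n | k != i) interaction G i k j * (x k j)%:R.

(* The zero profile seeds the arg min and arg max below; it is always feasible
   (opp_feasible0), so these are a genuine minimum and maximum. *)
Definition profile0 (n m : nat) : profile n m := [ffun=> [ffun=> false]].

Lemma opp_feasible0 (n m : nat) (G : kpg n m) (i : 'I_n) :
  opp_feasible G i (profile0 n m).
Proof.
apply/forallP => k; apply/implyP => _; rewrite /feasible big1 // => j _.
by rewrite !ffunE muln0.
Qed.

Definition pmin (n m : nat) (G : kpg n m) (i : 'I_n) (j : 'I_m) : int :=
  induced_profit G i j
    [arg min_(x < profile0 n m | opp_feasible G i x) induced_profit G i j x]%O.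

Definition pmax (n m : nat) (G : kpg n m) (i : 'I_n) (j : 'I_m) : int :=
  induced_profit G i j
    [arg max_(x > profile0 n m | opp_feasible G i x) induced_profit G i j x]%O.

(* An item of weight w and profit p dominates one of weight w' and profit p'. *)
Definition dominates (w : nat) (p : int) (w' : nat) (p' : int) : Prop :=
  (w <= w')%N /\ p' < p.

(* Unordered pairs of distinct players: the products x^i_j x^k_j and x^k_j x^i_j
   share one auxiliary variable. *)
Definition player_pair (n : nat) : finType := {e : 'I_n * 'I_n | (e.1 < e.2)%N}.

Definition lifted_space (R : realType) (n m : nat) : lmodType R :=
  ('M[R]_(n, m) * {ffun player_pair n * 'I_m -> R^o})%type.

Definition embed (R : realType) (n m : nat) (x : profile n m) : 'M[R]_(n, m) :=
  \matrix_(i < n, j < m) (x i j)%:R.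

Definition conv_hull (R : realType) (V : lmodType R) (A : set V) : set V :=
  smallest (@convex_set R V) A.

Definition lifted_feasible (R : realType) (n m : nat) (G : kpg n m) :
    set (lifted_space R n m) :=
  [set xz : lifted_space R n m |
    (exists2 s : profile n m, forall i, feasible G i (s i) & xz.1 = embed R s) /\
    forall (e : player_pair n) (j : 'I_m),
      let i := (val e).1 in let k := (val e).2 in
      [/\ xz.2 (e, j) = 0 \/ xz.2 (e, j) = 1,
          xz.2 (e, j) <= xz.1 i j, xz.2 (e, j) <= xz.1 k j &
          xz.1 i j + xz.1 k j - 1 <= xz.2 (e, j)]].

Definition perfect_equilibrium (R : realType) (n m : nat) (G : kpg n m) :
    set (lifted_space R n m) :=
  [set xz : lifted_space R n m | conv_hull (@lifted_feasible R n m G) xz /\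
            conv_hull [set embed R s | s in nash G] xz.1].

Definition equilibrium_inequality (R : realType) (n m : nat) (G : kpg n m)
    (lhs rhs : lifted_space R n m -> R) : Prop :=
  forall xz : lifted_space R n m, perfect_equilibrium G xz -> lhs xz <= rhs xz.

(* Main.v *)
(* Induced profits turn a player's utility into a linear function of their own
   strategy.  If an equilibrium packed [j'] but not [j], swapping the two items
   would keep the knapsack feasible and raise the utility by at least
   [pmin j - pmax j' > 0].  So every equilibrium satisfies the inequality, and
   the half-space it defines, being convex, contains their convex hull. *)
Require Import Defs.
From mathcomp Require Import all_boot all_order all_algebra.
From mathcomp Require Import all_classical all_reals.
From mathcomp Require Import unstable interval_inference convex.

Set Implicit Arguments.
Unset Strict Implicit.
Unset Printing Implicit Defensive.

Import Order.TTheory GRing.Theory Num.Theory.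

Local Open Scope classical_set_scope.
Local Open Scope ring_scope.

Section KnapsackGame.
Variables (n m : nat) (G : kpg n m).
Implicit Types (i : 'I_n) (j : 'I_m) (x : profile n m) (y : strategy m).

Lemma pmin_le i j x : opp_feasible G i x -> pmin G i j <= induced_profit G i j x.
Proof.
by move=> fx; rewrite /pmin; case: arg_minP => [|z _]; [exact: opp_feasible0 | exact].
Qed.

Lemma le_pmax i j x : opp_feasible G i x -> induced_profit G i j x <= pmax G i j.
Proof.
by move=> fx; rewrite /pmax; case: arg_maxP => [|z _]; [exact: opp_feasible0 | exact].
Qed.

(** The bilinear terms couple equal items only, so exchanging the two sums collects, for each item,
    the whole coefficient of [y j]. *)
Lemma utilityE i y x :
  utility G i y x = \sum_(j < m) induced_profit G i j x * (y j)%:R.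
Proof.
rewrite /utility exchange_big -big_split; apply: eq_bigr => j _ /=.
by rewrite mulrDl mulr_suml; congr +%R; apply: eq_bigr => k _; rewrite mulrAC.
Qed.

Definition swap_items j j' y : strategy m :=
  [ffun k => if k == j then true else if k == j' then false else y k].

(** Written without subtraction over a semiring, so that one identity serves both the weights in
    [nat] and the profits in [int]. *)
Lemma sum_swap_items (R : pzSemiRingType) (F : 'I_m -> R) j j' y :
  ~~ y j -> y j' ->
  \sum_(k < m) F k * (swap_items j j' y k)%:R + F j' =
  \sum_(k < m) F k * (y k)%:R + F j.
Proof.
move=> yj yj'; have j'j : j' != j by apply: contraNneq yj => <-.
rewrite (bigD1 j) //= (bigD1 j') //= [in RHS](bigD1 j) //= [in RHS](bigD1 j') //=.
under eq_bigr => k /andP[kj kj'] do rewrite ffunE (negPf kj) (negPf kj').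
rewrite !ffunE !eqxx (negPf j'j) (negPf yj) yj' !mulr0 !mulr1 !add0r.
by rewrite [LHS]addrC [F j + _]addrC addrA.
Qed.

Lemma feasible_swap_items i j j' y :
  ~~ y j -> y j' -> (weight G i j <= weight G i j')%N ->
  feasible G i y -> feasible G i (swap_items j j' y).
Proof.
move=> yj yj' wjj'; rewrite /feasible; apply: leq_trans.
have := sum_swap_items (weight G i) yj yj'.
(* In the semiring [nat] the cast [%:R] is the identity; removing it matches the sums in
   [feasible]. *)
under eq_bigr do rewrite natn; under [in RHS]eq_bigr do rewrite natn.
move=> e; rewrite -(leq_add2r (weight G i j')).
by rewrite [leqLHS]e leq_add2l.
Qed.

Lemma nash_dominated_item i j j' x :
  dominates (weight G i j) (pmin G i j) (weight G i j') (pmax G i j') ->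
  nash G x -> (x i j' <= x i j)%N.
Proof.
move=> [wjj' pjj'] Nx; case xj': (x i j') => //; rewrite lt0b.
apply: contraT => xj; have [fx /(_ (swap_items j j' (x i)))] := Nx i.
rewrite feasible_swap_items // => /(_ isT); rewrite !utilityE.
(* The opponents' equilibrium strategies are among those over which [pmin] and [pmax] are taken. *)
have fNx : opp_feasible G i x.
  by apply/forallP => k; apply/implyP => _; case: (Nx k).
(* After cancellation, optimality says that [j] has induced profit at most that of [j'], against the
   chain: profit of [j'] <= [pmax] < [pmin] <= profit of [j]. *)
rewrite -(lerD2r (induced_profit G i j' x)) sum_swap_items // lerD2l leNgt.
by rewrite (le_lt_trans (le_pmax j' fNx)) // (lt_le_trans pjj') // pmin_le.
Qed.

End KnapsackGame.

Lemma conv_hull_sub (R : realType) (V : lmodType R) (A B : set V) :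
  convex_set B -> A `<=` B -> conv_hull A `<=` B.
Proof. exact: smallest_sub. Qed.

Lemma convex_entry_le (R : realType) (n m : nat) (i : 'I_n) (j j' : 'I_m) :
  @convex_set R 'M[R]_(n, m) [set M | M i j' <= M i j].
Proof.
move=> M N t; rewrite !inE /= => leM leN; rewrite !mxE.
by rewrite lerD ?ler_wpM2l ?onem_ge0.
Qed.

Theorem proposition3 (R : realType) (n m : nat) (G : kpg n m) (i : 'I_n)
    (j j' : 'I_m)
    (dom : dominates (weight G i j) (pmin G i j) (weight G i j') (pmax G i j')) :
  equilibrium_inequality G
    (fun xz : lifted_space R n m => xz.1 i j')
    (fun xz : lifted_space R n m => xz.1 i j).
Proof.
move=> xz [_]; apply: (conv_hull_sub (@convex_entry_le R n m i j j')).
(* The generators of the hull have 0/1 entries, so the real inequality reduces to one between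
   naturals. *)
by move=> _ [s Ns <-] /=; rewrite !mxE ler_nat; exact: nash_dominated_item Ns.
Qed.
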